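(* Fix integers $n>1$ and $e\ge n-1$, and let $p$ be a prime. For each positive integer $t$, set $k = e - t(n-1)$, $c = \lceil e/t\rceil - (n-1)$ and $b = \lfloor e/t\rfloor - (n-1)$ (all depending on $t$). Set $$h(e,n) = \max_{\left\lceil\frac{e}{2(n-1)}\right\rceil \le t \le \left\lfloor\frac{e}{n-1}\right\rfloor} \left(k(n-1) - c^2(k+t-ct) - b^2(ct-k)\right),$$ where the maximum is over all integers $t$ in the indicated range. Then $$f_n(p^{e}) \ge p^{h(e,n)}.$$
   Context: A subring of $\mathbb{Z}^n$ is a sublattice (additive subgroup) of $\mathbb{Z}^n$ that contains the multiplicative identity $(1,1,\ldots,1)$ and is closed under componentwise multiplication. For a positive integer $m$, $f_n(m)$ denotes the number of subrings of $\mathbb{Z}^n$ of finite index $m$. *)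

(* Defs.v *)
From HB Require Import structures.
From mathcomp Require Import all_boot all_order all_algebra.
From mathcomp Require Import finmap boolp classical_sets functions cardinality.

Set Implicit Arguments.
Unset Strict Implicit.
Unset Printing Implicit Defensive.

Import Order.TTheory GRing.Theory Num.Theory.
Local Open Scope classical_set_scope.
Local Open Scope card_scope.
Local Open Scope ring_scope.

(* Z^n with its componentwise ring structure. *)
Notation Zn n := {ffun 'I_n -> int}.

Definition is_subring (n : nat) (L : set (Zn n)) : Prop :=
  GRing.subring_closed (mem L).

Definition coset (n : nat) (L : set (Zn n)) (x : Zn n) : set (Zn n) :=
  [set y | L (y - x)].

Definition has_index (n : nat) (L : set (Zn n)) (m : nat) : Prop :=
  range (coset L) #= `I_m.

(* [fset_set] sends an infinite set to the empty one, so a positive lower bound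
   on [num_subrings n m] entails that there are finitely many such subrings. *)
Definition num_subrings (n m : nat) : nat :=
  #|` fset_set [set L : set (Zn n) | is_subring L /\ has_index L m] |%fset.

Definition h_term (e n t : nat) : int :=
  let k := e%:Z - t%:Z * (n%:Z - 1) in
  let c := Num.ceil (e%:R / t%:R : rat) - (n%:Z - 1) in
  let b := Num.floor (e%:R / t%:R : rat) - (n%:Z - 1) in
  k * (n%:Z - 1) - c ^+ 2 * (k + t%:Z - c * t%:Z) - b ^+ 2 * (c * t%:Z - k).

Definition in_h_range (e n t : nat) : bool :=
  Num.ceil (e%:R / (2 * (n%:R - 1)) : rat) <= t%:Z
    <= Num.floor (e%:R / (n%:R - 1) : rat).

(* The bound [t < e.+1] only serves to make the index type finite, and the
   default value of the maximum is the term at the upper end of the range: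
   see [in_h_range_le] and [h_exp_attained]. *)
Definition h_exp (e n : nat) : int :=
  \big[Order.max/h_term e n (e %/ n.-1)]_(t < e.+1 | in_h_range e n t)
    h_term e n t.

Lemma in_h_range_le (e n t : nat) : (1 < n)%N -> in_h_range e n t -> (t <= e)%N.
Proof.
case: n => [|[|n]] // _ /andP[_].
rewrite -[n.+2%:R]natr1 addrK floor_ge_int ?ler_pdivlMr ?ltr0n //.
rewrite -[t%:Z%:~R]/(t%:R) -natrM ler_nat.
exact/leq_trans/leq_pmulr.
Qed.

Lemma in_h_range_divn (e n : nat) :
  (1 < n)%N -> (n.-1 <= e)%N -> in_h_range e n (e %/ n.-1).
Proof.
case: n => [|[|n]] //= _ le_ne; rewrite /in_h_range.
rewrite -[n.+2%:R]natr1 addrK ceil_le_int floor_ge_int.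
rewrite -![(_ %/ _)%N%:Z%:~R]/((_ %/ _)%N%:R).
rewrite ler_pdivrMr ?mulr_gt0 ?ltr0n // ler_pdivlMr ?ltr0n //.
rewrite -!natrM !ler_nat leq_divM andbT mulnCA mul2n -addnn {1}(divn_eq e n.+1).
rewrite leq_add2l; apply: leq_trans (ltnW (ltn_pmod _ _)) _ => //.
by rewrite leq_pmull // divn_gt0.
Qed.

Lemma h_exp_ge (e n t : nat) :
  (1 < n)%N -> in_h_range e n t -> h_term e n t <= h_exp e n.
Proof.
move=> n_gt1 et; have te := in_h_range_le n_gt1 et.
exact: (@le_bigmax_cond _ _ _ _ (Ordinal (te : (t < e.+1)%N))).
Qed.

Lemma h_exp_attained (e n : nat) : (1 < n)%N -> (n.-1 <= e)%N ->
  exists2 t : nat, in_h_range e n t & h_exp e n = h_term e n t.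
Proof.
move=> n_gt1 le_ne; rewrite /h_exp.
elim/big_ind: _ => [|x y [t et ->] [u eu ->]|t et].
- by exists (e %/ n.-1)%N; first exact: in_h_range_divn.
- by rewrite /Order.max; case: ifP => _; [exists u | exists t].
- by exists t.
Qed.

(* Main.v *)
Require Import Defs.
From mathcomp Require Import all_boot all_order all_algebra.
From mathcomp Require Import finmap boolp classical_sets functions cardinality.
From mathcomp Require Import zify ring.

Import Order.TTheory GRing.Theory Num.Theory.
Local Open Scope ring_scope.

Set Implicit Arguments.
Unset Strict Implicit.
Unset Printing Implicit Defensive.

(* Put [d = n - 1] and identify [Z^n / Z 1] with [Z^d]. Every lattice [N] with
   [p^(2t) Z^d <= N <= p^t Z^d] satisfies [N N <= N], so [Z 1 + N] is a subring
   of [Z^n]. Take for [N] the solutions [y] of [p^(t + s_i) | (U y)_i], where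
   [t >= s_0 >= s_1 >= ...] and [U] is upper unitriangular: the index is
   [p^(t d + \sum_i s_i)], and distinct matrices with entries
   [0 <= U_ij < p^(s_i - s_j)] give distinct lattices, [p^(\sum_(i<j) (s_i - s_j))]
   in number. Writing [e - t d = b t + r] with [r < t], the choice of [s] equal
   to [t] ([b] times), then [r], then [0], yields exactly the term of index [t]
   in the maximum defining [h(e, n)]. *)

(** * Finiteness of the set of subrings of a given index *)

Lemma absz_modz_lt (z : int) (M : nat) : (0 < M)%N -> (`|(z %% M%:Z)%Z| < M)%N.
Proof.
move=> M_gt0; rewrite -ltz_nat gez0_abs ?modz_ge0 ?ltz_pmod //; lia.
Qed.

Lemma eqz_abs_mod_dvd (x y : int) (M : nat) : (0 < M)%N ->
  (`|(x %% M%:Z)%Z|%N == `|(y %% M%:Z)%Z|%N) = (M%:Z %| x - y)%Z.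
Proof.
move=> M_gt0; have M0 : M%:Z != 0 by lia.
by rewrite -eqz_nat !gez0_abs ?modz_ge0 // eqz_mod_dvd.
Qed.

(** The cosets of [L] are the fibers of [g], and surjectivity keeps the fibers over distinct values
    distinct. *)
Lemma has_index_card (n : nat) (T : finType) (g : Zn n -> T) (L : set (Zn n)) :
  (forall v, exists x, g x = v) -> (forall x y, L (y - x) <-> g x = g y) ->
  has_index L #|T|.
Proof.
move=> g_surj gP; rewrite /has_index.
pose fiber v : set (Zn n) := [set y | v = g y]%classic.
have cosetE x : coset L x = fiber (g x).
  by apply/seteqP; split=> y /gP.
have -> : range (coset L) = (fiber @` setT)%classic.
  apply/seteqP; split=> A [x _ <-]; first by exists (g x); rewrite ?cosetE.
  by have [y <-] := g_surj x; exists y; rewrite ?cosetE.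
have fiber_inj : {in setT &, injective fiber}.
  move=> u v _ _ /seteqP[uv _]; have [x gx] := g_surj u.
  by rewrite (uv x (esym gx)) gx.
apply: (card_eq_trans (inj_card_eq fiber_inj)).
have -> : `I_#|T| = ((fun x : T => enum_rank x : nat) @` setT)%classic.
  apply/seteqP; split=> [i /= lt_iT|_ [x _ <-]] /=; last exact: ltn_ord.
  by exists (enum_val (Ordinal lt_iT)); rewrite ?enum_valK.
rewrite card_eq_sym; apply: inj_card_eq => x y _ _ /val_inj.
exact: enum_rank_inj.
Qed.

(** Pigeonhole: two of the [m + 1] multiples [0, x, ..., m x] share a coset, so [L] contains
    [(j - i) x] with [0 < j - i <= m], and [j - i] divides the factorial. *)
Lemma mulrn_fact_index (n m : nat) (L : set (Zn n)) :
  GRing.zmod_closed (mem L) -> has_index L m -> forall x, L (x *+ m`!).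
Proof.
move=> [L0 LB].
rewrite /has_index => /card_set_bijP[f [f_fun f_inj _]] x.
have ltf i : (f (coset L (x *+ i)) < m)%N.
  by apply: (f_fun (coset L (x *+ i))); exists (x *+ i).
have [i [j [lt_ij ef]]] : exists i : 'I_m.+1, exists j : 'I_m.+1,
    (i < j)%N /\ f (coset L (x *+ i)) = f (coset L (x *+ j)).
  pose h (i : 'I_m.+1) := Ordinal (ltf i).
  have /injectivePn[i [j ne_ij /(congr1 val) /= eh]] : ~~ injectiveb h.
    apply/injectiveP => /leq_card; rewrite !card_ord; lia.
  have [lt_ij|lt_ji|/val_inj e_ij] := ltngtP i j.
  - by exists i, j.
  - by exists j, i.
  - by rewrite e_ij eqxx in ne_ij.
have /seteqP[_ sub] : coset L (x *+ i) = coset L (x *+ j).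
  by apply: f_inj => //; rewrite in_setE; [exists (x *+ i)|exists (x *+ j)].
have Lij : L (x *+ (j - i)).
  rewrite mulrnBr 1?ltnW //; apply: sub.
  by rewrite /coset /= subrr -in_setE.
have Lmul k y : y \in L -> y *+ k \in L.
  have LD u v : u \in L -> v \in L -> u + v \in L.
    by move=> Lu Lv; rewrite -[v]opprK LB // -sub0r LB.
  move=> Ly; elim: k => [|k IHk]; first by rewrite mulr0n.
  by rewrite mulrS; apply: LD.
have ltjm := ltn_ord j.
have /dvdnP[q ->] : (j - i %| m`!)%N by apply: dvdn_fact; lia.
by rewrite mulnC mulrnA -in_setE Lmul ?in_setE.
Qed.

(** Such a subgroup is the full preimage of its image in [(Z/M)^n], a finite set with finitely many
    subsets. *)
Lemma finite_subgroups_mulrn (n M : nat) : (0 < M)%N ->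
  finite_set [set L : set (Zn n) |
    GRing.zmod_closed (mem L) /\ forall x, L (x *+ M)]%classic.
Proof.
move=> M_gt0.
have red_lt z := absz_modz_lt z M_gt0.
pose red (x : Zn n) : {ffun 'I_n -> 'I_M} := [ffun i => Ordinal (red_lt (x i))].
pose preim (B : {set {ffun 'I_n -> 'I_M}}) : set (Zn n) :=
  [set x | red x \in B]%classic.
apply: (sub_finite_set (B := range preim)); last first.
  exact/finite_image/finite_finset.
move=> L [[L0 LB] LM].
have LD u v : u \in L -> v \in L -> u + v \in L.
  by move=> Lu Lv; rewrite -[v]opprK LB // -sub0r LB.
exists [set v | `[< exists2 x, L x & red x = v >]] => //.
apply/seteqP; split=> x; rewrite /preim /= inE; last first.
  by move=> Lx; apply/asboolP; exists x.
move/asboolP=> [y Ly /ffunP e_red].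
rewrite -in_setE -[x](subrK y) LD ?in_setE //.
suff -> : x - y = [ffun i => ((x i - y i) %/ M%:Z)%Z] *+ M by exact: LM.
apply/ffunP => i; rewrite ffunMnE !ffunE.
have := e_red i; rewrite !ffunE => /(congr1 val) /= /esym/eqP.
by rewrite eqz_abs_mod_dvd // => /divzK {1}<-; rewrite pmulrn -mulrzr intz.
Qed.

Lemma finite_subrings (n m : nat) :
  finite_set [set L : set (Zn n) | is_subring L /\ has_index L m]%classic.
Proof.
apply: sub_finite_set (finite_subgroups_mulrn n (fact_gt0 m)).
move=> L [[L1 LB _] idxL].
have Lzmod : GRing.zmod_closed (mem L) by split=> //; rewrite -(subrr 1) LB.
by split=> //; apply: mulrn_fact_index.
Qed.

(** * Subrings cut out by congruences *)

Definition centered (d : nat) (x : Zn d.+1) : 'cV[int]_d :=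
  \col_i (x (lift ord0 i) - x ord0).

(** For invertible [U], the preimage in [Z^(d+1)] of [U^-1 diag(m) Z^d] under [centered], whose
    kernel is [Z 1]. *)
Definition congr_lattice (d : nat) (U : 'M[int]_d) (m : 'I_d -> nat) :
    set (Zn d.+1) :=
  [set x | forall i, ((m i)%:Z %| (U *m centered x) i ord0)%Z]%classic.

Lemma centeredB (d : nat) (x y : Zn d.+1) :
  centered (x - y) = centered x - centered y.
Proof. by apply/colP => i; rewrite !mxE !ffunE; ring. Qed.

Lemma centered_surj (d : nat) (y : 'cV[int]_d) :
  exists x : Zn d.+1, centered x = y.
Proof.
exists [ffun j => if unlift ord0 j is Some i then y i ord0 else 0].
by apply/colP => i; rewrite !mxE !ffunE liftK unlift_none subr0.
Qed.

(** Since [U] is invertible over the integers, the entries of [U *m centered x] realize every system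
    of residues modulo the [m i]. *)
Lemma congr_lattice_index (d : nat) (U : 'M[int]_d) (m : 'I_d -> nat) :
  U \in unitmx -> (forall i, 0 < m i)%N ->
  has_index (congr_lattice U m) (\prod_i m i).
Proof.
move=> Uu m_gt0.
pose T := {dffun forall i, 'I_(m i)}.
pose g (x : Zn d.+1) : T :=
  [ffun i => Ordinal (absz_modz_lt ((U *m centered x) i ord0) (m_gt0 i))].
have <- : #|T| = (\prod_i m i)%N.
  rewrite card_dep_ffun foldrE big_image /=.
  by apply: eq_bigr => i _; rewrite card_ord.
apply: (has_index_card (g := g)) => [v|x y].
  have [x xP] := centered_surj (invmx U *m \col_i (v i : nat)%:Z).
  exists x; apply/ffunP => i; apply/val_inj; rewrite ffunE /= xP mulKVmx // mxE.
  by rewrite modz_nat modn_small // ltn_ord.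
rewrite /congr_lattice /= centeredB mulmxBr; split=> [L|e_g i].
  apply/ffunP => i; apply/val_inj/eqP; rewrite !ffunE /= eq_sym.
  by rewrite eqz_abs_mod_dvd //; have := L i; rewrite !mxE.
have := congr1 (fun f : T => val (f i)) e_g; rewrite !ffunE /= => /esym/eqP.
by rewrite eqz_abs_mod_dvd // !mxE.
Qed.

Lemma dvdz_mulmx (a : int) (d k : nat) (A : 'M[int]_(k, d)) (y : 'cV[int]_d) :
  (forall i, a %| y i ord0)%Z -> forall i, (a %| (A *m y) i ord0)%Z.
Proof.
move=> ay i; rewrite mxE; apply: rpred_sum => j _.
exact: dvdz_mull.
Qed.

(* The last two hypotheses squeeze the lattice of centered vectors between
   [q Z^d] and [q^2 Z^d], so it contains all its pairwise products. *)
Lemma congr_lattice_subring (d q : nat) (U : 'M[int]_d) (m : 'I_d -> nat) :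
  U \in unitmx -> (forall i, q %| m i)%N -> (forall i, m i %| q ^ 2)%N ->
  is_subring (congr_lattice U m).
Proof.
move=> Uu qm mq.
have Lq x i : congr_lattice U m x -> (q%:Z %| centered x i ord0)%Z.
  move=> Lx; rewrite -(mulKmx Uu (centered x)); apply: dvdz_mulmx => {}i.
  by apply: dvdz_trans (Lx i); rewrite dvdzE qm.
split=> [|x y|x y]; rewrite ?in_setE.
- move=> i; have -> : centered 1 = 0 :> 'cV[int]_d.
    by apply/colP => j; rewrite !mxE !ffunE subrr.
  by rewrite mulmx0 mxE dvdz0.
- rewrite ?in_setE => Lx Ly i.
  rewrite centeredB mulmxBr mxE [X in _ + X]mxE.
  by apply: rpredB; [apply: Lx|apply: Ly].
rewrite ?in_setE => Lx Ly i.
pose z := \col_i (centered x i ord0 * centered y i ord0).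
(* Expand [(x0 1 + u) (y0 1 + v)], where [u] and [v] vanish at coordinate [0]: only [z], the product
   of [u] and [v], needs the squeeze. *)
have -> : centered (x * y) = z + (x ord0 *: centered y + y ord0 *: centered x).
  by apply/colP => j; rewrite !mxE !ffunE; ring.
rewrite !mulmxDr -!scalemxAr.
have Az : ((m i)%:Z %| (U *m z) i ord0)%Z.
  apply: (@dvdz_trans ((q ^ 2)%N%:Z)); first by rewrite dvdzE mq.
  apply: dvdz_mulmx => j.
  by rewrite mxE expnS expn1 PoszM dvdz_mul // Lq.
rewrite mxE; apply: rpredD => //; rewrite mxE.
by apply: rpredD; rewrite mxE; apply: dvdz_mull; [apply: Ly|apply: Lx].
Qed.

(** * Counting lattices by unitriangular matrices *)

Definition unitriangular (d : nat) (U : 'M[int]_d) : Prop :=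
  forall i j : 'I_d, (j <= i)%N -> U i j = (i == j)%:R.

Lemma unitriangular_unitmx (d : nat) (U : 'M[int]_d) :
  unitriangular U -> U \in unitmx.
Proof.
move=> Ut; rewrite unitmxE -det_tr det_trig; last first.
  by apply/is_trig_mxP => i j ij; rewrite mxE Ut ?(ltnW ij) // -val_eqE gtn_eqF.
by rewrite big1 ?unitr1 // => i _; rewrite mxE Ut // eqxx.
Qed.

(* Rows of [W = V U^-1] are compared with those of the identity from left to
   right: [W] maps [diag(m) Z^d] into itself, so [m i] divides [W i j * m j],
   while [W i j = V i j - U i j] once the earlier entries of the row agree. *)
Lemma congr_lattice_inj (d : nat) (U V : 'M[int]_d) (m : 'I_d -> nat) :
  unitriangular U -> unitriangular V ->
  (forall i j : 'I_d, (i < j)%N ->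
     ((m i)%:Z %| (V i j - U i j) * (m j)%:Z)%Z -> V i j = U i j) ->
  (congr_lattice U m `<=` congr_lattice V m)%classic -> U = V.
Proof.
move=> Ut Vt UV sub.
have Uu := unitriangular_unitmx Ut.
pose W := V *m invmx U.
have WU : W *m U = V by rewrite /W mulmxKV.
have dvdW i j : ((m i)%:Z %| W i j * (m j)%:Z)%Z.
  (* For this [x], [U *m centered x] is [m j] times the [j]-th basis vector, so [V *m centered x] is
     [m j] times column [j] of [W]. *)
  have [x xP] := centered_surj (invmx U *m ((m j)%:Z *: delta_mx j ord0)).
  have /sub/(_ i) : congr_lattice U m x.
    move=> l; rewrite xP mulKVmx // !mxE andbT.
    by case: eqP => [->|_]; rewrite ?mulr0 ?dvdz0 // dvdz_mulr.
  by rewrite xP mulmxA -/W -scalemxAr -colE !mxE mulrC.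
clearbody W; suff W1 : W = 1%:M by rewrite -WU W1 mul1mx.
apply/matrixP => i j; rewrite [RHS]mxE.
have [n] := ubnP (j : nat); elim: n j => // n IHn j; rewrite ltnS => le_jn.
have := congr1 (fun A : 'M_d => A i j) WU; rewrite mxE.
rewrite (bigD1 j) //= Ut // eqxx mulr1.
(* Induction gives [W i l] for [l < j]; triangularity kills [U l j] for [l > j]. *)
have Wl (l : 'I_d) : l != j -> W i l * U l j = (i == l)%:R * U l j.
  move=> ne_lj; have [lt_lj|lt_jl|/val_inj e_lj] := ltngtP l j.
  - by rewrite IHn // (leq_trans lt_lj).
  - by rewrite Ut ?(ltnW lt_jl) // (negPf ne_lj) !mulr0.
  - by rewrite e_lj eqxx in ne_lj.
rewrite (eq_bigr _ Wl).
have [e_ij|ne_ij] := eqVneq i j.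
  rewrite e_ij big1 ?addr0 => [|l ne_lj]; first by rewrite Vt ?eqxx.
  by rewrite eq_sym (negPf ne_lj) mul0r.
rewrite (bigD1 i) //= eqxx mul1r big1 ?addr0 => [|l /andP[_ ne_li]]; last first.
  by rewrite eq_sym (negPf ne_li) mul0r.
move=> /(canRL (addrK _)) Wij; rewrite Wij.
have [lt_ij|lt_ji|/val_inj e_ij] := ltngtP i j.
- by apply/eqP; rewrite subr_eq0; apply/eqP/UV; rewrite // -Wij.
- by rewrite Vt ?Ut ?(ltnW lt_ji) // subrr.
- by rewrite e_ij eqxx in ne_ij.
Qed.

Lemma card_ord_lt (M N : nat) : (M <= N)%N -> #|[pred v : 'I_N | (v < M)%N]| = M.
Proof.
by move=> le_MN; rewrite -sum1_card (big_ord_narrow le_MN) sum1_card card_ord.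
Qed.

Lemma num_subrings_ge (d t p : nat) (s : 'I_d -> nat) : (0 < p)%N ->
  (forall i j : 'I_d, (j <= i)%N -> (s i <= s j)%N) -> (forall i, s i <= t)%N ->
  (p ^ (\sum_i \sum_j (s i - s j))
    <= num_subrings d.+1 (p ^ (\sum_i (t + s i))))%N.
Proof.
move=> p_gt0 s_mono s_le.
(* For [j <= i] the truncated difference is [0], so the bound [p ^ 0 = 1] forces a zero entry: only
   entries above the diagonal vary. *)
pose F (ij : 'I_d * 'I_d) :=
  [pred v : 'I_(p ^ t) | (v < p ^ (s ij.1 - s ij.2))%N].
pose U (f : {ffun 'I_d * 'I_d -> 'I_(p ^ t)}) : 'M[int]_d :=
  \matrix_(i, j) ((i == j)%:R + (f (i, j) : nat)%:Z).
pose m i := (p ^ (t + s i))%N.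
have cardF : #|family F| = (p ^ (\sum_i \sum_j (s i - s j)))%N.
  rewrite card_family foldrE big_image pair_bigA /= expn_sum.
  apply: eq_bigr => -[i j] _; rewrite card_ord_lt // leq_pexp2l //=.
  exact: leq_trans (leq_subr _ _) (s_le i).
have Ut f : f \in family F -> unitriangular (U f).
  move=> /familyP fF i j le_ji; rewrite mxE; have := fF (i, j).
  rewrite inE /= (eqP (s_mono _ _ le_ji : _ - _ == 0)%N) expn0 ltnS leqn0.
  by move/eqP->; rewrite addr0.
have U_inj : {in family F &, injective (fun f => congr_lattice (U f) m)}.
  move=> f g fF gF eL.
  have : U f = U g.
    apply: (@congr_lattice_inj _ _ _ m); [exact: Ut|exact: Ut| |by rewrite eL].
    move=> i j lt_ij; rewrite !mxE -val_eqE (ltn_eqF lt_ij) !add0r.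
    have le_s := s_mono _ _ (ltnW lt_ij).
    (* Cancelling [m j] leaves a congruence modulo [p ^ (s i - s j)] between two naturals below that
       modulus. *)
    have -> : m i = (p ^ (s i - s j) * m j)%N.
      by rewrite /m -expnD addnCA subnK.
    rewrite PoszM dvdz_mul2r; last by rewrite eqz_nat -lt0n expn_gt0 p_gt0.
    rewrite -eqz_mod_dvd !modz_nat eqz_nat !modn_small; first by move/eqP->.
      by move/familyP: fF => /(_ (i, j)).
    by move/familyP: gF => /(_ (i, j)).
  move=> /matrixP eU; apply/ffunP => -[i j]; apply/val_inj.
  by have := eU i j; rewrite !mxE => /addrI [].
rewrite -cardF /num_subrings.
have -> : #|family F| = #|` [fset congr_lattice (U f) m | f in family F]%fset|.
  by rewrite card_in_imfset //= cardE.
apply/fsubset_leq_card/fsubsetP => L /imfsetP[f /= fF ->].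
rewrite in_fset_set ?in_setE; last exact: finite_subrings.
have Uu := unitriangular_unitmx (Ut f fF).
split.
  apply: (@congr_lattice_subring _ (p ^ t)) => // i.
    by rewrite /m dvdn_exp2l // leq_addr.
  by rewrite /m -expnM dvdn_exp2l // muln2 -addnn leq_add2l.
rewrite expn_sum; apply: congr_lattice_index => // i.
by rewrite expn_gt0 p_gt0.
Qed.

(** * The exponent as a double sum *)

Definition step (b t r i : nat) : nat :=
  if (i < b)%N then t else if i == b then r else 0.

(** The length [b + q.+1] reserves a place for [r] between the [b] copies of [t] and the [q] zeros;
    the case of [b] filling the whole length is treated separately. *)
Lemma sum_step (F : nat -> nat) (b q t r : nat) :
  (\sum_(i < b + q.+1) F (step b t r i) = b * F t + (F r + q * F 0))%N.
Proof.
rewrite big_split_ord /= big_ord_recl /=.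
congr (_ + (_ + _))%N.
- rewrite (eq_bigr (fun=> F t)) => [|i _]; last by rewrite /step /= ltn_ord.
  by rewrite sum_nat_const card_ord.
- by rewrite /step addn0 ltnn eqxx.
rewrite (eq_bigr (fun=> F 0)) => [|i _]; last first.
  by rewrite /step /= /bump /= ltnNge leq_addr -{2}[b]addn0 eqn_add2l.
by rewrite sum_nat_const card_ord.
Qed.

Lemma in_h_rangeP (d e t : nat) : (0 < d)%N -> in_h_range e d.+1 t ->
  (t * d <= e <= 2 * t * d)%N.
Proof.
move=> d_gt0; rewrite /in_h_range -[d.+1%:R]natr1 addrK.
rewrite ceil_le_int floor_ge_int -[t%:Z%:~R]/(t%:R).
rewrite ler_pdivrMr ?mulr_gt0 ?ltr0n // ler_pdivlMr ?ltr0n //.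
by rewrite -!natrM !ler_nat => /andP[le1 ->]; rewrite mulnAC mulnC.
Qed.

Lemma floor_divn (b t r : nat) : (r < t)%N ->
  Num.floor ((b * t + r)%N%:R / t%:R : rat) = b%:Z.
Proof.
move=> lt_rt; have t_gt0 : (0 < t)%N by lia.
apply: floor_def; rewrite ler_pdivlMr ?ltr_pdivrMr ?ltr0n //.
rewrite (_ : b%:Z + 1 = b.+1%:Z); last by rewrite intS addrC.
rewrite -!pmulrn -!natrM ler_nat ltr_nat; lia.
Qed.

Lemma ceil_divn (b t r : nat) : (r < t)%N ->
  Num.ceil ((b * t + r)%N%:R / t%:R : rat) = (b + (0 < r))%N%:Z.
Proof.
move=> lt_rt; have t_gt0 : (0 < t)%N by lia.
apply: ceil_def; rewrite rmorphB rmorph1 ltrBlDr ler_pdivrMr ?ltr0n //.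
rewrite -ltrBlDr ltr_pdivlMr ?ltr0n // mulrBl ltrBlDr -!pmulrn.
rewrite -!natrM mul1r -natrD ler_nat ltr_nat; lia.
Qed.

(** As [e = (d + b) t + r], the [b] of [h_term] is this [b], and its [c] is [b + (0 < r)]. With
    [d = b + q + 1], both sides equal [b (t - r) + q (b t + r)]. *)
Lemma h_termE (d t b r : nat) : (r < t)%N -> (b * t + r <= t * d)%N ->
  h_term (t * d + (b * t + r)) d.+1 t
    = (\sum_(i < d) \sum_(j < d) (step b t r i - step b t r j))%N%:Z.
Proof.
move=> lt_rt le_d; rewrite /h_term.
have -> : (t * d + (b * t + r) = (d + b) * t + r)%N by lia.
rewrite floor_divn // ceil_divn //.
have [lt_bd|le_db] := ltnP b d.
  have [q ->] : exists q, d = (b + q.+1)%N by exists (d - b.+1)%N; lia.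
  under eq_bigr => i _ do rewrite (sum_step (fun x => (step b t r i - x)%N)).
  rewrite (sum_step (fun x => b * (x - t) + (x - r + q * (x - 0)))%N).
  rewrite !subnn !sub0n !subn0 !muln0 !addn0.
  have [u ->] : exists u, t = (r + u)%N by exists (t - r)%N; lia.
  rewrite -addnBAC // subnn add0n.
  by case: r {lt_rt le_d} => [|r] /=; lia.
(* Here [step] is constantly [t] on the range, and both sides vanish. *)
have [r0 bd] : r = 0 /\ b = d by nia.
rewrite big1 => [|i _]; last first.
  by rewrite big1 // => j _; rewrite /step !bd !ltn_ord subnn.
rewrite r0 bd; lia.
Qed.

Theorem theorem1p8 (n e p : nat) (n_gt1 : (1 < n)%N) (e_ge : (n - 1 <= e)%N)
    (p_prime : prime p) :
  (p%:R : rat) ^ (h_exp e n) <= (num_subrings n (p ^ e)%N)%:R.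
Proof.
case: n n_gt1 e_ge => // d d_gt0; rewrite subn1 => e_ge.
have [t /(in_h_rangeP d_gt0)/andP[le_te le_et] ->] :=
  h_exp_attained (d_gt0 : 1 < d.+1)%N e_ge.
have t_gt0 : (0 < t)%N by case: t le_et {le_te} => //; lia.
pose k := (e - t * d)%N; pose b := (k %/ t)%N; pose r := (k %% t)%N.
have lt_rt : (r < t)%N by rewrite ltn_mod.
have kE : k = (b * t + r)%N := divn_eq k t.
have eE : e = (t * d + (b * t + r))%N by rewrite -kE subnKC.
clearbody b r; rewrite {k kE} in eE *.
(* The lower end of the range of [t] gives [e <= 2 t d], so the [s_i], each at most [t], can sum to
   [e - t d]. *)
have le_d : (b * t + r <= t * d)%N by lia.
rewrite eE h_termE // -exprnP -natrX ler_nat.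
have -> : (t * d + (b * t + r) = \sum_(i < d) (t + step b t r i))%N.
  rewrite big_split sum_nat_const card_ord mulnC; congr addn.
  have [lt_bd|le_db] := ltnP b d.
    have -> : d = (b + (d - b.+1).+1)%N by lia.
    by rewrite (sum_step id) muln0 addn0.
  have [-> ->] : r = 0 /\ b = d by nia.
  rewrite (eq_bigr (fun=> t)) => [|i _]; last by rewrite /step ltn_ord.
  by rewrite sum_nat_const card_ord addn0.
apply: num_subrings_ge => [|i j|i]; first exact: prime_gt0.
  by rewrite /step; do ?case: ifP; lia.
by rewrite /step; do ?case: ifP; lia.
Qed.
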